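(* Let $K$ be a closed convex cone in $H(M_A,M_B)$. The following are equivalent: (i) $K\circ \mathbb{CP}_{A}\subset K$. (ii) For all $\phi\in H(M_A,M_B)$: $\phi\in K^\circ$ if and only if $(1_A\otimes\phi)(\mathrm C_\psi)\in \mathrm C_{K^\circ}$ for every $\psi\in\mathbb{CP}_{A}$. (iii) For all $\phi\in H(M_A,M_B)$: $\phi\in K^\circ$ if and only if $(1_B\otimes \psi)(\mathrm C_{\phi^*})\in \mathrm C_{(K^{*})^\circ}$ for every $\psi\in\mathbb{CP}_{A}$. (iv) For all $\phi\in H(M_A,M_B)$: $\phi\in K^\circ$ if and only if $(1_A\otimes\sigma^* )(\mathrm C_\phi)\in \mathcal P_{AA}$ for every $\sigma\in K$. (v) For all $\phi\in H(M_A,M_B)$: $\phi\in K^\circ$ if and only if $(1_A\otimes \phi^* )(\mathrm C_\sigma)\in \mathcal P_{AA}$ for every $\sigma \in K$. The following are also equivalent: (vi) $\mathbb{CP}_{B}\circ K\subset K$. (vii) For all $\phi\in H(M_A,M_B)$: $\phi\in K^\circ$ if and only if $(\phi^*\otimes 1_B)(\mathrm C_{\psi})\in \mathrm C_{K^\circ}$ for every $\psi\in\mathbb{CP}_B$. (viii) For all $\phi\in H(M_A,M_B)$: $\phi\in K^\circ$ if and only if $(\psi\otimes 1_A)(\mathrm C_{\phi^*})\in \mathrm C_{(K^{*})^\circ}$ for every $\psi\in\mathbb{CP}_B$. (ix) For all $\phi\in H(M_A,M_B)$: $\phi\in K^\circ$ if and only if $(\sigma\otimes 1_B)(\mathrm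 C_\phi)\in \mathcal P_{BB}$ for every $\sigma\in K$. (x) For all $\phi\in H(M_A,M_B)$: $\phi\in K^\circ$ if and only if $(\phi\otimes 1_B)(\mathrm C_\sigma)\in \mathcal P_{BB}$ for every $\sigma\in K$.
   Context: $M_A, M_B$ are the full complex matrix algebras acting on finite-dimensional Hilbert spaces $\mathbb C^A,\mathbb C^B$; $1_A,1_B$ are the identity maps on $M_A,M_B$. $H(M_A,M_B)$ is the real vector space of Hermitian-preserving linear maps $M_A\to M_B$, i.e. those with $\phi(a^* )=\phi(a)^*$ for all $a$. On a matrix algebra use the bilinear pairing $\langle a,b\rangle=\operatorname{Tr}(a^{\mathrm t}b)=\sum_{i,j}a_{ij}b_{ij}$ ($\mathrm t$ is transpose; no complex conjugation). The adjoint $\phi^*:M_B\to M_A$ of a linear map $\phi:M_A\to M_B$ is defined with respect to this pairing: $\langle\phi(a),b\rangle=\langle a,\phi^*(b)\rangle$ for all $a\in M_A$, $b\in M_B$. The Choi matrix of a linear map $\phi:M_A\to M_B$ is $\mathrm C_\phi=\sum_{i,j}e_{ij}\otimes\phi(e_{ij})\in M_A\otimes M_B$, with $e_{ij}$ the matrix units of the domain $M_A$ (similarly for other domains and ranges), and $\mathrm C_K=\{\mathrm C_\phi:\phi\in K\}$. The bilinear pairing on maps is $\langle\phi,\psi\rangle=\langle \mathrm C_\phi,\mathrm C_\psi\rangle$. For a subset $K\subset H(M_A,M_B)$: $K^\circ=\{\psi\in H(M_A,M_B):\langle\phi,\psi\rangle\ge 0\text{ for every }\phi\in K\}$ (and similarly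 in $H(M_B,M_A)$), and $K^*=\{\phi^*:\phi\in K\}\subset H(M_B,M_A)$. For sets of maps, $K_1\circ K_0=\{\phi_1\circ\phi_0:\phi_1\in K_1,\phi_0\in K_0\}$. $\mathbb{CP}_A$ (resp. $\mathbb{CP}_B$) is the convex cone of completely positive linear maps $M_A\to M_A$ (resp. $M_B\to M_B$). $\mathcal P_{AA}$, $\mathcal P_{BB}$ are the sets of positive semidefinite matrices in $M_A\otimes M_A$, $M_B\otimes M_B$. *)

(* Defs.v *)
From HB Require Import structures.
From mathcomp Require Import all_boot all_order all_algebra.
From mathcomp Require Export spectral sesquilinear.
From mathcomp Require Export complex mxtens.
From mathcomp Require Export boolp classical_sets reals topology normedtype.
Export numFieldNormedType.Exports.

Set Implicit Arguments.
Unset Strict Implicit.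
Unset Printing Implicit Defensive.

Import Order.TTheory GRing.Theory Num.Theory.
Local Open Scope ring_scope.
Local Open Scope classical_set_scope.
Local Open Scope sesquilinear_scope.

(* [M_A] is ['M[C]_a], [M_A (x) M_B] is ['M[C]_(a * b)] with the library's
   Kronecker product [*t], and a linear map [M_A -> M_B] is an element of
   ['Hom('M[C]_a, 'M[C]_b)]; [C] is meant to be [R[i]] for [R : realType]. *)

Section Maps.
Variable C : numClosedFieldType.
Local Notation Map a b := 'Hom('M[C]_a, 'M[C]_b).

Definition psdmx (n : nat) : set 'M[C]_n :=
  [set X | X ^t* = X /\ forall v : 'cV[C]_n, 0 <= (v ^t* *m X *m v) 0 0].

(* Bilinear: no complex conjugation. *)
Definition pairing (n : nat) (x y : 'M[C]_n) : C := \tr (x^T *m y).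

Lemma pairingE (n : nat) (x y : 'M[C]_n) :
  pairing x y = \sum_i \sum_j x i j * y i j.
Proof.
rewrite /pairing /mxtrace exchange_big; apply: eq_bigr => j _ /=.
by rewrite mxE; apply: eq_bigr => i _; rewrite mxE.
Qed.

Definition adjoint_fun (a b : nat) (f : Map a b) (y : 'M[C]_b) : 'M[C]_a :=
  \matrix_(i, j) pairing (f (delta_mx i j)) y.

Fact adjoint_fun_is_linear (a b : nat) (f : Map a b) : linear (adjoint_fun f).
Proof.
move=> c x y; apply/matrixP => i j; rewrite !mxE /pairing.
by rewrite mulmxDr -scalemxAr mxtraceD mxtraceZ.
Qed.

HB.instance Definition _ (a b : nat) (f : Map a b) :=
  GRing.isLinear.Build C _ _ _ _ (adjoint_fun_is_linear f).

Definition adjoint (a b : nat) (f : Map a b) : Map b a :=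
  linfun (adjoint_fun f).

Lemma adjointP (a b : nat) (f : Map a b) (x : 'M[C]_a) (y : 'M[C]_b) :
  pairing (f x) y = pairing x (adjoint f y).
Proof.
rewrite lfunE /= [RHS]pairingE {1}[x]matrix_sum_delta linear_sum /pairing.
rewrite linear_sum mulmx_suml linear_sum; apply: eq_bigr => i _ /=.
rewrite !linear_sum mulmx_suml linear_sum; apply: eq_bigr => j _ /=.
by rewrite !linearZ /= -scalemxAl mxtraceZ mxE.
Qed.

Definition choi (a b : nat) (f : Map a b) : 'M[C]_(a * b) :=
  \sum_(i < a) \sum_(j < a) delta_mx i j *t f (delta_mx i j).

Lemma choiE (a b : nat) (f : Map a b) (i j : 'I_a) (k l : 'I_b) :
  choi f (mxtens_index (i, k)) (mxtens_index (j, l)) = f (delta_mx i j) k l.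
Proof.
rewrite /choi summxE (bigD1 i) //= summxE (bigD1 j) //= tensmxE mxE !eqxx mul1r.
rewrite !big1 ?addr0 // => [i' ne|j' ne].
  rewrite summxE big1 // => j' _.
  by rewrite tensmxE mxE eq_sym (negPf ne) mul0r.
by rewrite tensmxE mxE eqxx eq_sym (negPf ne) mul0r.
Qed.

Definition map_pairing (a b : nat) (f g : Map a b) : C :=
  pairing (choi f) (choi g).

(* [f (x) g], given by its values on the matrix units [e_ij (x) e_kl]. *)
Definition tensmap (a b c d : nat) (f : Map a b) (g : Map c d)
    (X : 'M[C]_(a * c)) : 'M[C]_(b * d) :=
  \sum_(i < a) \sum_(j < a) \sum_(k < c) \sum_(l < c)
    X (mxtens_index (i, k)) (mxtens_index (j, l)) *:
      (f (delta_mx i j) *t g (delta_mx k l)).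

Lemma tensmapE (a b c d : nat) (f : Map a b) (g : Map c d)
    (x : 'M[C]_a) (y : 'M[C]_c) :
  tensmap f g (x *t y) = f x *t g y.
Proof.
apply/matrixP => u v; rewrite -[u]mxtens_unindexK -[v]mxtens_unindexK.
case: (mxtens_unindex u) (mxtens_unindex v) => [p r] [q s].
rewrite [RHS]mxE !mxtens_indexK /=.
rewrite [in RHS](matrix_sum_delta x) [in RHS](matrix_sum_delta y) !linear_sum.
rewrite !summxE big_distrl; apply: eq_bigr => i _ /=.
rewrite !linear_sum !summxE big_distrl; apply: eq_bigr => j _ /=.
rewrite summxE big_distrr; apply: eq_bigr => k _ /=.
rewrite !linear_sum !summxE big_distrr; apply: eq_bigr => l _ /=.
by rewrite !linearZ /= !mxE !mxtens_indexK /= mulrACA.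
Qed.

Definition idmap (n : nat) : Map n n := \1%VF.

(* [H(M_A, M_B)] *)
Definition hermitian_preserving (a b : nat) : set (Map a b) :=
  [set f | forall x : 'M[C]_a, f (x ^t*) = (f x) ^t*].

Definition completely_positive (a b : nat) : set (Map a b) :=
  [set f | forall (k : nat) (X : 'M[C]_(k * a)),
    psdmx X -> psdmx (tensmap (idmap k) f X)].

(* Scalars are real: in [C], [0 <= s] means that [s] is real and nonnegative. *)
Definition convex_cone (a b : nat) (K : set (Map a b)) : Prop :=
  K !=set0 /\
  forall (f g : Map a b) (s t : C), K f -> K g -> 0 <= s -> 0 <= t ->
    K (s *: f + t *: g).

(* ['Hom] carries no topology in the library; [choi] is a linear isomorphism
   onto a finite-dimensional matrix space, whose (unique) vector space topology
   is used instead. [C^o] is [C] with the topology of its norm. *)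
Definition closed_maps (a b : nat) (K : set (Map a b)) : Prop :=
  closed ([set choi f | f in K] : set 'M[C^o]_(a * b)).

Definition closed_convex_cone (a b : nat) (K : set (Map a b)) : Prop :=
  convex_cone K /\ closed_maps K.

(* The pairing of two Hermitian-preserving maps is always real. *)
Definition dual_cone (a b : nat) (K : set (Map a b)) : set (Map a b) :=
  [set g | hermitian_preserving g /\ forall f, K f -> 0 <= map_pairing f g].

Definition adjoint_set (a b : nat) (K : set (Map a b)) : set (Map b a) :=
  @adjoint a b @` K.

Definition choi_set (a b : nat) (K : set (Map a b)) : set 'M[C]_(a * b) :=
  @choi a b @` K.

Definition comp_set (a b c : nat) (K1 : set (Map b c)) (K0 : set (Map a b)) :
    set (Map a c) :=
  [set (f1 \o f0)%VF | f1 in K1 & f0 in K0].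

End Maps.

Arguments idmap {C}.
Arguments completely_positive {C}.
Arguments hermitian_preserving {C}.

(* Main.v *)
Require Import Defs.
From HB Require Import structures.
From mathcomp Require Import all_boot all_order all_algebra.
From mathcomp Require Import ring.
From mathcomp Require Import all_classical reals topology normedtype.
From mathcomp Require Import derive matrix_normedtype.

(* Composition is compatible with the bilinear pairing: <s p, f> = <p, s* f> =
   <s, f p*>.  Since the completely positive maps form a self-dual cone stable
   under adjoints, the five conditions on each side all say that
   <sigma psi, phi> >= 0 (resp. <psi sigma, phi> >= 0) for phi in the dual cone,
   sigma in K and psi completely positive.  By the bipolar theorem this is the
   stability of K under composition with completely positive maps.  The bipolar
   theorem itself comes from the nearest point of a closed convex cone. *)

Set Implicit Arguments.
Unset Strict Implicit.
Unset Printing Implicit Defensive.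

Import Order.TTheory GRing.Theory Num.Theory.
Import numFieldTopology.Exports numFieldNormedType.Exports.
Local Open Scope ring_scope.
Local Open Scope classical_set_scope.
Local Open Scope sesquilinear_scope.

Section Algebra.
Variable C : numClosedFieldType.
Local Notation Map a b := 'Hom('M[C]_a, 'M[C]_b).

(** * Pair indices of Kronecker products, matrix entries of maps, and the pairing of matrices *)

Lemma mxtens_index_bij m n : bijective (@mxtens_index m n).
Proof.
by exists (@mxtens_unindex m n); [exact: mxtens_indexK|exact: mxtens_unindexK].
Qed.

Lemma big_mxtens_index m n (F : 'I_(m * n) -> C) :
  \sum_u F u = \sum_i \sum_j F (mxtens_index (i, j)).
Proof.
rewrite pair_bigA (reindex (@mxtens_index m n)) /=.
  by apply: eq_bigr => -[].
exact/onW_bij/mxtens_index_bij.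
Qed.

Lemma mxtens_matrixP m n (X Y : 'M[C]_(m * n)) :
  (forall i j k l, X (mxtens_index (i, k)) (mxtens_index (j, l)) =
                   Y (mxtens_index (i, k)) (mxtens_index (j, l))) -> X = Y.
Proof.
move=> XY; apply/matrixP => u v; rewrite -[u]mxtens_unindexK -[v]mxtens_unindexK.
by case: (mxtens_unindex u) (mxtens_unindex v) => [i k] [j l]; exact: XY.
Qed.

Lemma hom_mxE a b (f : Map a b) x k l :
  f x k l = \sum_i \sum_j x i j * f (delta_mx i j) k l.
Proof.
rewrite {1}[x]matrix_sum_delta linear_sum summxE; apply: eq_bigr => i _ /=.
rewrite linear_sum summxE; apply: eq_bigr => j _ /=.
by rewrite linearZ mxE.
Qed.

Lemma hom_mxP a b (f g : Map a b) :
  (forall i j k l, f (delta_mx i j) k l = g (delta_mx i j) k l) -> f = g.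
Proof.
move=> fg; apply/lfunP => x; apply/matrixP => k l; rewrite hom_mxE [RHS]hom_mxE.
by apply: eq_bigr => i _; apply: eq_bigr => j _; rewrite fg.
Qed.

Lemma pairingC n (x y : 'M[C]_n) : pairing x y = pairing y x.
Proof.
rewrite !pairingE; apply: eq_bigr => i _; apply: eq_bigr => j _.
exact: mulrC.
Qed.

Lemma pairingDl n (x y z : 'M[C]_n) :
  pairing (x + y) z = pairing x z + pairing y z.
Proof. by rewrite /pairing linearD mulmxDl linearD. Qed.

Lemma pairingZl n c (x z : 'M[C]_n) : pairing (c *: x) z = c * pairing x z.
Proof. by rewrite /pairing linearZ -scalemxAl linearZ. Qed.

Lemma pairingBl n (x y z : 'M[C]_n) :
  pairing (x - y) z = pairing x z - pairing y z.
Proof. by rewrite pairingDl -scaleN1r pairingZl mulN1r. Qed.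

Lemma pairing_deltal n i j (y : 'M[C]_n) : pairing (delta_mx i j) y = y i j.
Proof.
rewrite pairingE (bigD1 i) //= (bigD1 j) //= mxE !eqxx mul1r !big1 ?addr0 //.
- move=> k ki; apply: big1 => l _; by rewrite mxE (negPf ki) mul0r.
- by move=> l lj; rewrite mxE (negPf lj) andbF mul0r.
Qed.

(** Conjugating the sum exchanges the two indices, because both matrices are Hermitian. *)
Lemma pairing_real n (X Y : 'M[C]_n) :
  X ^t* = X -> Y ^t* = Y -> pairing X Y \is Num.real.
Proof.
move=> Xh Yh; apply/CrealP; rewrite !pairingE rmorph_sum /= exchange_big.
apply: eq_bigr => i _ /=; rewrite rmorph_sum; apply: eq_bigr => j _ /=.
by rewrite rmorphM -{2}Xh -{2}Yh !mxE.
Qed.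

(** * The Choi isomorphism *)

Lemma choi_linear a b : linear (@choi C a b).
Proof.
move=> c f g; apply: mxtens_matrixP => i j k l.
by rewrite 2!mxE !choiE add_lfunE scale_lfunE !mxE.
Qed.

Lemma choiB a b (f g : Map a b) : choi (f - g) = choi f - choi g.
Proof. by rewrite addrC -scaleN1r choi_linear scaleN1r addrC. Qed.

Lemma choi_inj a b : injective (@choi C a b).
Proof.
move=> f g fg; apply: hom_mxP => i j k l.
by rewrite -!choiE fg.
Qed.

(** The inverse of [choi]: the first tensor factor of [X] is contracted with [x]. *)
Definition unchoi_fun a b (X : 'M[C]_(a * b)) (x : 'M[C]_a) : 'M[C]_b :=
  \matrix_(k, l) \sum_i \sum_j
    x i j * X (mxtens_index (i, k)) (mxtens_index (j, l)).

Fact unchoi_fun_is_linear a b (X : 'M[C]_(a * b)) : linear (unchoi_fun X).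
Proof.
move=> c x y; apply/matrixP => k l; rewrite !mxE mulr_sumr -big_split.
apply: eq_bigr => i _ /=; rewrite mulr_sumr -big_split; apply: eq_bigr => j _ /=.
by rewrite !mxE mulrDl mulrA.
Qed.

HB.instance Definition _ a b (X : 'M[C]_(a * b)) :=
  GRing.isLinear.Build C _ _ _ (unchoi_fun X) (unchoi_fun_is_linear X).

Lemma choi_surj a b (X : 'M[C]_(a * b)) : exists f : Map a b, choi f = X.
Proof.
exists (linfun (unchoi_fun X)); apply: mxtens_matrixP => i j k l.
rewrite choiE lfunE mxE.
pose Y := \matrix_(p, q) X (mxtens_index (p, k)) (mxtens_index (q, l)).
transitivity (pairing (delta_mx i j) Y); last by rewrite pairing_deltal mxE.
rewrite pairingE; apply: eq_bigr => p _; apply: eq_bigr => q _.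
by rewrite [Y _ _]mxE.
Qed.

(** * Adjoints and compositions under the pairing of maps *)

Lemma map_pairingE a b (f g : Map a b) :
  map_pairing f g = \sum_i \sum_j pairing (f (delta_mx i j)) (g (delta_mx i j)).
Proof.
rewrite /map_pairing pairingE big_mxtens_index; apply: eq_bigr => i _.
under eq_bigr do rewrite big_mxtens_index.
rewrite exchange_big; apply: eq_bigr => j _ /=.
rewrite pairingE; apply: eq_bigr => k _; apply: eq_bigr => l _.
by rewrite !choiE.
Qed.

Lemma adjointE a b (f : Map a b) i j k l :
  adjoint f (delta_mx k l) i j = f (delta_mx i j) k l.
Proof. by rewrite lfunE mxE pairingC pairing_deltal. Qed.

Lemma adjointK a b (f : Map a b) : adjoint (adjoint f) = f.
Proof. by apply: hom_mxP => i j k l; rewrite !adjointE. Qed.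

Lemma adjoint_comp a b c (g : Map b c) (f : Map a b) :
  adjoint (g \o f)%VF = (adjoint f \o adjoint g)%VF.
Proof.
apply: hom_mxP => k l i j; rewrite adjointE !comp_lfunE.
by rewrite -[RHS]pairing_deltal -!adjointP pairingC pairing_deltal.
Qed.

(** Passing to the adjoint only exchanges the domain indices with the range indices, and the pairing
    sums over all four. *)
Lemma map_pairing_adjoint a b (f g : Map a b) :
  map_pairing (adjoint f) (adjoint g) = map_pairing f g.
Proof.
rewrite !map_pairingE.
under eq_bigr do under eq_bigr do rewrite pairingE.
under [RHS]eq_bigr do under eq_bigr do rewrite pairingE.
rewrite pair_bigA [RHS]pair_bigA /=.
under eq_bigr do rewrite pair_bigA.
under [RHS]eq_bigr do rewrite pair_bigA.
rewrite exchange_big; apply: eq_bigr => -[i j] _; apply: eq_bigr => -[k l] _ /=.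
by rewrite !adjointE.
Qed.

Lemma map_pairing_compl a b c (g : Map b c) (f : Map a b) (h : Map a c) :
  map_pairing (g \o f)%VF h = map_pairing f (adjoint g \o h)%VF.
Proof.
rewrite !map_pairingE; apply: eq_bigr => i _; apply: eq_bigr => j _.
by rewrite !comp_lfunE adjointP.
Qed.

(** Taking adjoints reverses the composition, which reduces this to moving the left factor. *)
Lemma map_pairing_compr a b c (g : Map b c) (f : Map a b) (h : Map a c) :
  map_pairing (g \o f)%VF h = map_pairing g (h \o adjoint f)%VF.
Proof.
rewrite -map_pairing_adjoint adjoint_comp map_pairing_compl.
by rewrite -[RHS]map_pairing_adjoint adjoint_comp.
Qed.

(** * Tensor products of maps acting on Choi matrices *)

Lemma tensmap_sum (a b c d : nat) (f : Map a b) (g : Map c d) I (r : seq I) P F :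
  tensmap f g (\sum_(i <- r | P i) F i) = \sum_(i <- r | P i) tensmap f g (F i).
Proof.
rewrite /tensmap; do 4!(rewrite [RHS]exchange_big; apply: eq_bigr => ? _ /=).
by rewrite summxE scaler_suml.
Qed.

Lemma tensmap_choi a b c d (f : Map a b) (g : Map c d) (h : Map a c) :
  tensmap f g (choi h) =
  \sum_i \sum_j f (delta_mx i j) *t g (h (delta_mx i j)).
Proof.
rewrite /choi tensmap_sum; apply: eq_bigr => i _.
by rewrite tensmap_sum; apply: eq_bigr => j _; rewrite tensmapE.
Qed.

Lemma tensmap_idl_choi a c d (g : Map c d) (h : Map a c) :
  tensmap (idmap a) g (choi h) = choi (g \o h)%VF.
Proof.
rewrite tensmap_choi; apply: eq_bigr => i _; apply: eq_bigr => j _.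
by rewrite id_lfunE comp_lfunE.
Qed.

(** The first tensor factor of a Choi matrix indexes the argument of the map, so acting on it by [f]
    amounts to precomposing with the adjoint of [f]. *)
Lemma tensmap_idr_choi a b c (f : Map a b) (h : Map a c) :
  tensmap f (idmap c) (choi h) = choi (h \o adjoint f)%VF.
Proof.
rewrite tensmap_choi; apply: mxtens_matrixP => i j k l.
rewrite choiE comp_lfunE hom_mxE summxE; apply: eq_bigr => p _.
rewrite summxE; apply: eq_bigr => q _.
by rewrite tensmxE id_lfunE adjointE.
Qed.

(** * Hermitian-preserving maps *)

Lemma hermitian_preservingP a b (f : Map a b) :
  hermitian_preserving a b f <->
  forall i j k l, f (delta_mx i j) k l = (f (delta_mx j i) l k)^*.
Proof.
split=> [fH i j k l|fE x].
  have := fH (delta_mx j i); rewrite trmx_delta map_delta_mx => ->.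
  by rewrite !mxE.
apply/matrixP => k l; rewrite !mxE hom_mxE [in RHS]hom_mxE.
rewrite rmorph_sum exchange_big; apply: eq_bigr => i _ /=.
rewrite rmorph_sum; apply: eq_bigr => j _ /=.
by rewrite !mxE rmorphM fE.
Qed.

Lemma choi_hermitian a b (f : Map a b) :
  hermitian_preserving a b f <-> (choi f) ^t* = choi f.
Proof.
rewrite hermitian_preservingP; split=> [fE|fE i j k l].
  by apply: mxtens_matrixP => i j k l; rewrite !mxE !choiE [RHS]fE.
by rewrite -!choiE -{1}fE !mxE.
Qed.

Lemma hermitian_preserving_comp a b c (g : Map b c) (f : Map a b) :
  hermitian_preserving b c g -> hermitian_preserving a b f ->
  hermitian_preserving a c (g \o f)%VF.
Proof. by move=> gH fH x; rewrite !comp_lfunE fH gH. Qed.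

Lemma hermitian_preserving_adjoint a b (f : Map a b) :
  hermitian_preserving a b f -> hermitian_preserving b a (adjoint f).
Proof.
by move=> /hermitian_preservingP fE; apply/hermitian_preservingP => i j k l;
  rewrite !adjointE fE.
Qed.

(** * Positive semidefinite matrices and their self-duality *)

Lemma psdmxP n (X : 'M[C]_n) :
  psdmx X <-> X ^t* = X /\
  forall v : 'I_n -> C, 0 <= \sum_i \sum_j (v i)^* * X i j * v j.
Proof.
have formE v : (v ^t* *m X *m v) 0 0 = \sum_i \sum_j (v i 0)^* * X i j * v j 0.
  rewrite mxE exchange_big; apply: eq_bigr => j _ /=.
  by rewrite mxE mulr_suml; apply: eq_bigr => i _; rewrite !mxE.
split=> -[Xh Xp]; split=> // v.
  have := Xp (\col_i v i); rewrite formE.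
  by under eq_bigr do under eq_bigr do rewrite !mxE.
by rewrite formE.
Qed.

Lemma psdmx_congr m n (X : 'M[C]_m) (W : 'M[C]_(m, n)) :
  psdmx X -> psdmx (W ^t* *m X *m W).
Proof.
move=> [Xh Xp]; split=> [|v].
  by rewrite !trmx_mul !map_mxM /= trmxCK Xh mulmxA.
by have := Xp (W *m v); rewrite trmx_mul map_mxM !mulmxA.
Qed.

Lemma psdmx_rank1 n (v : 'I_n -> C) : psdmx (\matrix_(i, j) (v i * (v j)^*)).
Proof.
apply/psdmxP; split=> [|w].
  by apply/matrixP => i j; rewrite !mxE rmorphM /= conjCK mulrC.
rewrite (_ : \sum_i _ = (\sum_i (w i)^* * v i) * (\sum_i (w i)^* * v i)^*).
  exact: mul_conjC_ge0.
rewrite mulr_suml; apply: eq_bigr => i _.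
rewrite rmorph_sum mulr_sumr; apply: eq_bigr => j _.
by rewrite !mxE rmorphM /= conjCK -!mulrA [w j * _]mulrC.
Qed.

(** By the spectral theorem the pairing is a sum of values of the quadratic form of [Y], weighted by
    the eigenvalues of [X]. *)
Lemma pairing_psdmx_ge0 n (X Y : 'M[C]_n) :
  psdmx X -> psdmx Y -> 0 <= pairing X Y.
Proof.
move=> [Xh Xp] /psdmxP[_ Yp].
have Xherm : X \is hermsymmx by apply/is_hermitianmxP; rewrite expr0 scale1r Xh.
have /orthomx_spectralP := hermitian_normalmx Xherm.
have := spectral_unitarymx X.
set P := spectralmx X; set d := spectral_diag X => Pu.
rewrite invmx_unitary // => XE.
(* Each eigenvalue is a value of the quadratic form of [X], hence nonnegative. *)
have dE k : d 0 k = \sum_i \sum_j P k i * X i j * (P k j)^*.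
  transitivity ((P *m X *m P ^t*) k k).
    rewrite XE !mulmxA (unitarymxP Pu) mul1mx -mulmxA (unitarymxP Pu) mulmx1.
    by rewrite mxE eqxx.
  rewrite mxE exchange_big; apply: eq_bigr => j _ /=.
  by rewrite mxE mulr_suml; apply: eq_bigr => i _; rewrite !mxE.
have d_ge0 k : 0 <= d 0 k.
  have /psdmxP[_ /(_ (fun i => (P k i)^*))] := conj Xh Xp.
  by rewrite dE; under eq_bigr do under eq_bigr do rewrite conjCK.
have XijE i j : X i j = \sum_k d 0 k * ((P k i)^* * P k j).
  rewrite XE mxE; apply: eq_bigr => k _.
  by rewrite mul_mx_diag !mxE mulrAC mulrC.
suff -> : pairing X Y =
    \sum_k d 0 k * \sum_i \sum_j (P k i)^* * Y i j * P k j.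
  by apply: sumr_ge0 => k _; apply: mulr_ge0.
rewrite pairingE; under [RHS]eq_bigr do rewrite mulr_sumr.
rewrite [RHS]exchange_big; apply: eq_bigr => i _ /=.
under [RHS]eq_bigr do rewrite mulr_sumr.
rewrite [RHS]exchange_big; apply: eq_bigr => j _ /=.
rewrite XijE mulr_suml; apply: eq_bigr => k _.
by rewrite -!mulrA [Y i j * _]mulrC.
Qed.

(** Rank-one matrices suffice as tests. The vector is conjugated because the pairing is bilinear. *)
Lemma psdmx_self_dual n (X : 'M[C]_n) : X ^t* = X ->
  (forall Y, psdmx Y -> 0 <= pairing Y X) -> psdmx X.
Proof.
move=> Xh Xp; apply/psdmxP; split=> // v.
have := Xp _ (psdmx_rank1 (fun i => (v i)^*)); rewrite pairingE.
congr (0 <= _); apply: eq_bigr => i _; apply: eq_bigr => j _.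
by rewrite mxE conjCK mulrAC.
Qed.

(* The quadratic form of [choi (g \o f)] at [v] is the pairing of [choi f] with
   a congruence of [choi g]. *)
Lemma psdmx_choi_comp a b c (g : Map b c) (f : Map a b) :
  psdmx (choi g) -> psdmx (choi f) -> psdmx (choi (g \o f)%VF).
Proof.
move=> gP fP; apply/psdmxP; split=> [|v].
  apply/choi_hermitian/hermitian_preserving_comp; apply/choi_hermitian.
  - by case: gP.
  - by case: fP.
(* [W] sends [e_i (x) e_l] to [e_l (x) v_i], where [v_i] is the block of [v] at [i]. The congruence
   of [choi g] by [W] thus has as entries the sesquilinear forms of [g (delta_mx k l)] at [v_i] and
   [v_j]. *)
pose W : 'M[C]_(b * c, a * b) := \matrix_(s, t)
  (((mxtens_unindex s).1 == (mxtens_unindex t).2)%:R *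
   v (mxtens_index ((mxtens_unindex t).1, (mxtens_unindex s).2))).
have := pairing_psdmx_ge0 fP (psdmx_congr W gP); congr (0 <= _).
have WE k p i l : W (mxtens_index (k, p)) (mxtens_index (i, l)) =
    (k == l)%:R * v (mxtens_index (i, p)) by rewrite mxE !mxtens_indexK.
have YE i k j l :
  (W ^t* *m choi g *m W) (mxtens_index (i, k)) (mxtens_index (j, l)) =
  \sum_p \sum_q (v (mxtens_index (i, p)))^* * g (delta_mx k l) p q *
     v (mxtens_index (j, q)).
  rewrite mxE big_mxtens_index (bigD1 l) //= [X in _ + X]big1 => [|l' /negPf ll'];
    last by apply: big1 => q _; rewrite WE ll' mul0r mulr0.
  rewrite addr0 exchange_big; apply: eq_bigr => q _ /=.
  rewrite WE eqxx mul1r mxE mulr_suml big_mxtens_index (bigD1 k) //=.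
  rewrite [X in _ + X]big1 => [|k' /negPf kk'];
    last by apply: big1 => p _;
      rewrite !mxE !mxtens_indexK /= kk' mul0r rmorph0 !mul0r.
  rewrite addr0; apply: eq_bigr => p _.
  by rewrite choiE !mxE !mxtens_indexK /= eqxx mul1r.
rewrite pairingE !big_mxtens_index; apply: eq_bigr => i _ /=.
under eq_bigr do rewrite big_mxtens_index.
under [RHS]eq_bigr do rewrite big_mxtens_index.
rewrite exchange_big [RHS]exchange_big; apply: eq_bigr => j _ /=.
under eq_bigr do under eq_bigr do rewrite choiE YE mulr_sumr.
under [RHS]eq_bigr do under eq_bigr do
  rewrite choiE comp_lfunE hom_mxE mulr_sumr mulr_suml.
under eq_bigr do rewrite exchange_big.
rewrite exchange_big; apply: eq_bigr => p _ /=.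
under eq_bigr do under eq_bigr do rewrite mulr_sumr.
under eq_bigr do rewrite exchange_big.
rewrite exchange_big; apply: eq_bigr => q _ /=.
apply: eq_bigr => k _; rewrite mulr_sumr mulr_suml; apply: eq_bigr => l _.
by rewrite !mulrA; congr (_ * _ * _); rewrite mulrC.
Qed.

(** * Complete positivity through Choi matrices *)

(** This is the rank-one matrix of the unnormalized maximally entangled vector. *)
Lemma psdmx_choi_id a : psdmx (choi (idmap a : Map a a)).
Proof.
have := psdmx_rank1 (fun u : 'I_(a * a) =>
  ((mxtens_unindex u).1 == (mxtens_unindex u).2)%:R).
congr psdmx; apply: mxtens_matrixP => i j k l.
rewrite choiE id_lfunE !mxE !mxtens_indexK /= conjC_nat -natrM mulnb.
by rewrite [k == i]eq_sym [l == j]eq_sym.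
Qed.

(** Choi's theorem. For the converse, every matrix [X] is the Choi matrix of some [g], so that
    amplifying [f] turns into composing it with [g]. *)
Lemma completely_positiveP a b (f : Map a b) :
  completely_positive a b f <-> psdmx (choi f).
Proof.
split=> [fCP|fP k X].
  by have := fCP a _ (psdmx_choi_id a); rewrite tensmap_idl_choi comp_lfun1r.
have [g <-] := choi_surj X; rewrite tensmap_idl_choi.
exact: psdmx_choi_comp.
Qed.

Lemma completely_positive_id a : completely_positive a a (idmap a : Map a a).
Proof. exact/completely_positiveP/psdmx_choi_id. Qed.

Lemma completely_positive_hermitian a b (f : Map a b) :
  completely_positive a b f -> hermitian_preserving a b f.
Proof. by move=> /completely_positiveP[fh _]; apply/choi_hermitian. Qed.

Lemma completely_positive_adjoint a b (f : Map a b) :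
  completely_positive a b f -> completely_positive b a (adjoint f).
Proof.
move=> fCP; apply/completely_positiveP/psdmxP; split.
  exact/choi_hermitian/hermitian_preserving_adjoint/completely_positive_hermitian.
move: fCP => /completely_positiveP/psdmxP[_ fp] v.
(* The Choi matrix of the adjoint is that of [f] with its tensor factors exchanged; [w] is [v] after
   the same exchange. *)
pose w u := v (mxtens_index ((mxtens_unindex u).2, (mxtens_unindex u).1)).
have := fp w; congr (0 <= _).
rewrite !big_mxtens_index exchange_big; apply: eq_bigr => k _ /=.
apply: eq_bigr => i _; rewrite !big_mxtens_index exchange_big.
apply: eq_bigr => l _; apply: eq_bigr => j _.
by rewrite !choiE adjointE /w !mxtens_indexK.
Qed.

Lemma map_pairing_completely_positive a b (f g : Map a b) :
  completely_positive a b f -> completely_positive a b g ->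
  0 <= map_pairing f g.
Proof.
by move=> /completely_positiveP fP /completely_positiveP; apply: pairing_psdmx_ge0.
Qed.

Lemma completely_positive_self_dual a b (f : Map a b) :
  hermitian_preserving a b f ->
  (forall g, completely_positive a b g -> 0 <= map_pairing g f) ->
  completely_positive a b f.
Proof.
move=> /choi_hermitian fh fp; apply/completely_positiveP/psdmx_self_dual => // Y.
have [g <-] := choi_surj Y => gP; exact/fp/completely_positiveP.
Qed.

End Algebra.

(** * Nearest points of closed sets, over the reals and then for complex matrices *)

(** The squared Euclidean distance is continuous, and its minimum may be sought in a compact box
    around [x]. *)
Lemma nearest_point_rV (R : realType) n (A : set 'rV[R]_n) (x : 'rV[R]_n) :
  closed A -> A !=set0 ->
  exists2 p, A p & forall q, A q ->
    \sum_i (p 0 i - x 0 i) ^+ 2 <= \sum_i (q 0 i - x 0 i) ^+ 2.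
Proof.
move=> Acl [s As].
pose g (r : 'rV[R]_n) := \sum_i (r 0 i - x 0 i) ^+ 2.
(* Adding 1 gives [1 <= M], so a square at most [M] comes from a number of absolute value at most
   [M]; this avoids square roots. *)
pose M := 1 + g s.
have g_ge0 r : 0 <= g r by apply: sumr_ge0 => i _; exact: sqr_ge0.
pose B := [set r : 'rV[R]_n | forall i, `[x 0 i - M, x 0 i + M]%classic (r ord0 i)].
have Bc : compact B.
  by apply: (@rV_compact _ _ (fun i => `[x 0 i - M, x 0 i + M]%classic)) => i;
    exact: segment_compact.
have gB r : g r <= g s -> B r.
  move=> grs i /=; rewrite in_itv /= -ler_distlC distrC.
  have : `|r 0 i - x 0 i| ^+ 2 <= M.
    rewrite real_normK ?num_real //; apply: (le_trans _ (ler_wpDl ler01 grs)).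
    by rewrite /g (bigD1 i) //= lerDl; apply: sumr_ge0 => j _; exact: sqr_ge0.
  apply: contraTT; rewrite -!ltNge => Mlt.
  have M1 : 1 <= M by rewrite lerDl.
  rewrite (lt_le_trans Mlt) // expr2 ler_peMr // ltW //.
  exact: le_lt_trans Mlt.
have gc : continuous g.
  move=> r; apply: cvg_big => [||i _]; [exact: add_continuous|exact: nbhs_filter|].
  have dc : (fun t : 'rV[R]_n => t 0 i - x 0 i) @ r --> r 0 i - x 0 i.
    apply: cvgB; [exact: nbhs_filter|exact: coord_continuous|].
    by apply: cvg_cst; exact: nbhs_filter.
  by apply: cvgM; [exact: nbhs_filter|exact: dc|exact: dc].
have [] := @compact_EVT_min _ _ g (A `&` B).
- by exists s; split => //; exact: gB.
- by apply: (subclosed_compact _ Bc); [apply: closedI => //; exact: compact_closed|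
    apply: subIsetr].
- exact: continuous_subspaceT.
move=> p; rewrite inE => -[Ap _] pmin; exists p => // q Aq.
(* A point farther from [x] than [s] is handled by comparison with [s], which lies in the box. *)
have [/gB Bq|/ltW gsq] := leP (g q) (g s).
  by apply: pmin; rewrite inE.
by apply: le_trans gsq; apply: pmin; rewrite inE; split => //; exact: gB.
Qed.

Section ComplexMatrices.
Variables (R : realType) (m n : nat).
Local Notation C := R[i].

(** All the real parts come first, then all the imaginary parts. This carries the real Euclidean
    distance to the Hilbert-Schmidt distance. *)
Definition complex_mx_of_rV (r : 'rV[R]_(m * n + m * n)) : 'M[C]_(m, n) :=
  \matrix_(i, j) Complex (vec_mx (lsubmx r) i j) (vec_mx (rsubmx r) i j).

Definition rV_of_complex_mx (X : 'M[C]_(m, n)) : 'rV[R]_(m * n + m * n) :=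
  row_mx (mxvec (map_mx (@complex.Re R) X)) (mxvec (map_mx (@complex.Im R) X)).

Lemma rV_of_complex_mxK : cancel rV_of_complex_mx complex_mx_of_rV.
Proof.
move=> X; apply/matrixP => i j.
rewrite mxE row_mxKl row_mxKr !mxvecK !mxE.
by case: (X i j).
Qed.

Lemma complex_mx_of_rV_continuous :
  continuous (complex_mx_of_rV : _ -> 'M[C^o]_(m, n)).
Proof.
move=> /= r U /= /(nbhs_ballP (complex_mx_of_rV r : 'M[C^o]_(m, n)))[e /= e0 eU].
have /complex_realP[e' eE] := gtr0_real e0.
have e'0 : 0 < e' by rewrite -ltcR -eE.
(* Half of the radius goes to the real part and half to the imaginary part. *)
have e20 : 0 < e' / 2 by rewrite divr_gt0.
apply/nbhs_ballP; exists (e' / 2) => //= s [_ rs]; apply: eU; split=> // i j.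
rewrite /ball /= !mxE.
have rsk k : `|r 0 k - s 0 k| < e' / 2 by exact: rs.
have norm_le (z : C) : `|z| <= (`|complex.Re z| + `|complex.Im z|)%:C%C.
  rewrite {1}[z]complexE; apply: le_trans (ler_normD _ _) _.
  rewrite normrM !normc_def /= !(expr0n, addr0, add0r, expr1n) sqrtr1 mul1r.
  by rewrite !sqrtr_sqr -rmorphD.
apply: le_lt_trans (norm_le _) _.
by rewrite eE ltcR /= [ltRHS]splitr ltrD ?rsk.
Qed.

Lemma sqr_norm_complex_mx (r x : 'rV[R]_(m * n + m * n)) :
  (\sum_k (r 0 k - x 0 k) ^+ 2)%:C%C =
  \sum_i \sum_j `|complex_mx_of_rV r i j - complex_mx_of_rV x i j| ^+ 2.
Proof.
rewrite pair_bigA big_split_ord /= !(reindex _ (curry_mxvec_bij m n)) /=.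
rewrite -big_split rmorph_sum; apply: eq_bigr => -[i j] _ /=.
by rewrite -add_Re2_Im2 !mxE.
Qed.

Lemma nearest_point_complex_mx (A : set 'M[C]_(m, n)) (x : 'M[C]_(m, n)) :
  closed (A : set 'M[C^o]_(m, n)) -> A !=set0 ->
  exists2 p, A p & forall q, A q ->
    \sum_i \sum_j `|p i j - x i j| ^+ 2 <= \sum_i \sum_j `|q i j - x i j| ^+ 2.
Proof.
move=> Acl [s As].
have [||p Ap pmin] := @nearest_point_rV R _ (complex_mx_of_rV @^-1` A)
  (rV_of_complex_mx x).
- by move/continuous_closedP: complex_mx_of_rV_continuous; exact.
- by exists (rV_of_complex_mx s); rewrite /= rV_of_complex_mxK.
exists (complex_mx_of_rV p) => // q Aq.
have := pmin (rV_of_complex_mx q); rewrite /= rV_of_complex_mxK => /(_ Aq).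
by rewrite -lecR !sqr_norm_complex_mx !rV_of_complex_mxK.
Qed.

End ComplexMatrices.

(** * Variational inequality and the bipolar theorem *)

Section Duality.
Variable C : numClosedFieldType.

Lemma sum_sqr_norm_hermitian n (X : 'M[C]_n) :
  X ^t* = X -> \sum_i \sum_j `|X i j| ^+ 2 = \tr (X *m X).
Proof.
move=> Xh; rewrite /mxtrace; apply: eq_bigr => i _.
rewrite mxE; apply: eq_bigr => j _.
by rewrite normCK; congr (_ * _); rewrite -[in RHS]Xh !mxE.
Qed.

Lemma trace_hermitian_sqr_ge0 n (X : 'M[C]_n) : X ^t* = X -> 0 <= \tr (X *m X).
Proof.
move=> /sum_sqr_norm_hermitian <-.
by apply: sumr_ge0 => i _; apply: sumr_ge0 => j _; exact: exprn_ge0.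
Qed.

(** The first-order condition for a minimum of the squared norm at [X] in the direction [Y],
    obtained from one explicit [t] instead of a limit. *)
Lemma trace_ge0_of_min n (X Y : 'M[C]_n) : X ^t* = X -> Y ^t* = Y ->
  (forall t, 0 < t -> t <= 1 ->
    \tr (X *m X) <= \tr ((X + t *: Y) *m (X + t *: Y))) ->
  0 <= \tr (Y *m X).
Proof.
move=> Xh Yh Xmin; set z := \tr (Y *m X); pose N := \tr (Y *m Y).
have N_ge0 : 0 <= N := trace_hermitian_sqr_ge0 Yh.
have zR : z \is Num.real.
  rewrite /z -[Y]trmxK; apply: pairing_real => //.
  by rewrite -map_trmx Yh.
(* Expand the square, cancel the norm of [X] and divide by [t]. *)
have zle t : 0 < t -> t <= 1 -> 0 <= z *+ 2 + t * N.
  move=> t0 t1; rewrite -(pmulr_rge0 _ t0); move: (Xmin t t0 t1).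
  rewrite -subr_ge0; congr (0 <= _).
  rewrite mulmxDl !mulmxDr -!scalemxAl -!scalemxAr !linearD !linearZ /=.
  rewrite [\tr (X *m Y)]mxtrace_mulC -/z -/N; ring.
rewrite real_leNgt ?real0 //; apply/negP => z_lt0.
have Nz0 : 0 < N - z by rewrite ltr_wpDl // oppr_gt0.
(* For negative [z] this [t] lies in the allowed range and makes the expression equal to
   [z * (N - z *+ 2) / (N - z)], which is negative. *)
have := zle (- z / (N - z)).
rewrite divr_gt0 ?oppr_gt0 // ler_pdivrMr // mul1r lerDr => /(_ isT N_ge0).
rewrite -(pmulr_lge0 _ Nz0).
have -> : (z *+ 2 + - z / (N - z) * N) * (N - z) = z * (N - z *+ 2).
  by field; rewrite gt_eqF.
by rewrite nmulr_rge0 // lt_geF // mulr2n opprD addrA addr_gt0 ?oppr_gt0.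
Qed.

Lemma hermitian_preservingB a b (f g : 'Hom('M[C]_a, 'M[C]_b)) :
  hermitian_preserving a b f -> hermitian_preserving a b g ->
  hermitian_preserving a b (f - g).
Proof.
by move=> fH gH x; rewrite !add_lfunE !opp_lfunE fH gH linearB map_mxB.
Qed.
Lemma map_pairingBl a b (f g h : 'Hom('M[C]_a, 'M[C]_b)) :
  map_pairing (f - g) h = map_pairing f h - map_pairing g h.
Proof. by rewrite /map_pairing choiB pairingBl. Qed.

(** The residual [D] at the nearest point [p] defines an element [g] of the dual cone that would
    separate [f] from [K]. Nonnegativity of [g] at [f] forces [D] to vanish, so [f] is [p]. *)
Lemma bipolar_of_nearest_point a b (K : set 'Hom('M[C]_a, 'M[C]_b)) f p :
  K `<=` hermitian_preserving a b -> convex_cone K ->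
  hermitian_preserving a b f -> K p ->
  (forall q, K q -> \sum_i \sum_j `|choi p i j - choi f i j| ^+ 2 <=
                    \sum_i \sum_j `|choi q i j - choi f i j| ^+ 2) ->
  (forall g, dual_cone K g -> 0 <= map_pairing f g) -> K f.
Proof.
move=> KH [_ Kconv] fH Kp pmin fK.
pose D := choi (p - f).
have Dh : D ^t* = D.
  exact/choi_hermitian/hermitian_preservingB/fH/KH.
(* The segment from [p] to [q] stays in [K], and the distance to [f] is least at its end [p]. *)
have descent q : K q -> 0 <= \tr (choi (q - p) *m D).
  move=> Kq; apply: trace_ge0_of_min => // [|t t0 t1].
    exact/choi_hermitian/hermitian_preservingB/KH/Kp/KH.
  have Kpt : K ((1 - t) *: p + t *: q).
    by apply: Kconv => //; [rewrite subr_ge0|exact: ltW].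
  have DE : D + t *: choi (q - p) = choi ((1 - t) *: p + t *: q - f).
    rewrite /D addrC -choi_linear; congr choi.
    rewrite addrC scalerBr scalerBl scale1r addrAC; congr (_ - _).
    by rewrite addrA addrAC.
  rewrite DE -!sum_sqr_norm_hermitian //; last first.
    exact/choi_hermitian/hermitian_preservingB/fH/KH.
  have BE (h : 'Hom('M[C]_a, 'M[C]_b)) i j :
    choi (h - f) i j = choi h i j - choi f i j by rewrite choiB !mxE.
  under eq_bigr do under eq_bigr do rewrite BE.
  under [leRHS]eq_bigr do under eq_bigr do rewrite BE.
  exact: pmin.
have K0 : K 0.
  by have := Kconv p p 0 0 Kp Kp (lexx _) (lexx _); rewrite !scale0r addr0.
(* On Hermitian matrices the bilinear pairing with [D^T] is the inner product
   with [D]. *)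
have [g gE] := choi_surj D^T.
have pairE q : map_pairing q g = \tr (choi q *m D).
  by rewrite /map_pairing gE /pairing -trmx_mul mxtrace_tr mxtrace_mulC.
have gdual : dual_cone K g.
  split=> [|q Kq]; first by apply/choi_hermitian; rewrite gE -map_trmx Dh.
  (* Taking [p + q] in the cone as endpoint leaves exactly [q] as direction. *)
  rewrite pairE; have := descent (p + q); rewrite addrAC subrr add0r; apply.
  by have := Kconv p q 1 1 Kp Kq ler01 ler01; rewrite !scale1r.
have := fK _ gdual; rewrite pairE => fD_ge0.
(* The direction from [p] to 0 shows that [g] is nonpositive at [p]. *)
have := descent _ K0; rewrite -pairE map_pairingBl -[0 in X in X - _](subrr p).
rewrite map_pairingBl subrr sub0r oppr_ge0 => p_le0.
(* The squared norm of [D] is the value of [g] at [p] minus its value at [f], hence at most 0. *)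
have DD0 : \tr (D *m D) = 0.
  apply/eqP; rewrite eq_le trace_hermitian_sqr_ge0 // andbT -pairE map_pairingBl.
  by rewrite subr_le0 (le_trans p_le0) // pairE.
suff -> : f = p by [].
apply/choi_inj/esym/eqP; rewrite -subr_eq0 -choiB -/D; apply/eqP.
have /eqP := DD0; rewrite -sum_sqr_norm_hermitian // psumr_eq0 => [/allP D0|i _];
  last by apply: sumr_ge0 => j _; exact: exprn_ge0.
apply/matrixP => i j; rewrite [RHS]mxE.
have /eqP/eqP := D0 i (mem_index_enum i); rewrite psumr_eq0 => [/allP /(_ j)|k _];
  last exact: exprn_ge0.
by rewrite mem_index_enum sqrf_eq0 normr_eq0 => /(_ isT)/eqP.
Qed.

End Duality.

Lemma bipolar (R : realType) (a b : nat) (K : set 'Hom('M[R[i]]_a, 'M[R[i]]_b)) f :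
  K `<=` hermitian_preserving a b -> closed_convex_cone K ->
  hermitian_preserving a b f ->
  (forall g, dual_cone K g -> 0 <= map_pairing f g) -> K f.
Proof.
move=> KH [Kcone Kcl] fH fK; have [[s Ks] _] := Kcone.
have [|_ [p Kp <-] pmin] := @nearest_point_complex_mx R _ _ _ (choi f) Kcl.
  by exists (choi s); exists s.
apply: (bipolar_of_nearest_point KH Kcone fH Kp _ fK) => q Kq.
by apply: pmin; exists q.
Qed.

(** * Stability under composition with completely positive maps *)

Section MappingCones.
Variables (C : numClosedFieldType) (a b : nat).
Local Notation Map := 'Hom('M[C]_a, 'M[C]_b).
Variable K : set Map.
Hypothesis KH : K `<=` hermitian_preserving a b.
(** Convexity and closedness of [K] enter the equivalences only in this form. *)
Hypothesis K_bipolar : forall f, hermitian_preserving a b f ->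
  (forall g, dual_cone K g -> 0 <= map_pairing f g) -> K f.

Lemma choi_setP (c d : nat) (L : set 'Hom('M[C]_c, 'M[C]_d)) f :
  choi_set L (choi f) <-> L f.
Proof. by split=> [[g Lg /choi_inj <-]|Lf]; last by exists f. Qed.

Lemma dual_cone_adjoint (f : 'Hom('M[C]_b, 'M[C]_a)) :
  dual_cone (adjoint_set K) f <-> dual_cone K (adjoint f).
Proof.
split=> -[fH fp]; split=> [|g Kg].
- exact: hermitian_preserving_adjoint.
- by rewrite -map_pairing_adjoint adjointK; apply: fp; exists g.
- by rewrite -(adjointK f); exact: hermitian_preserving_adjoint.
- by case: Kg => h Kh <-; rewrite -map_pairing_adjoint adjointK; exact: fp.
Qed.

Lemma completely_positive_adjointP (c d : nat) (f : 'Hom('M[C]_c, 'M[C]_d)) :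
  completely_positive d c (adjoint f) <-> completely_positive c d f.
Proof.
split; last exact: completely_positive_adjoint.
by move=> /completely_positive_adjoint; rewrite adjointK.
Qed.

(** The conditions are proved in a cycle. In terms of compositions, the second and third put
    [phi \o psi] or [phi \o adjoint psi] in the dual cone; the last two make [adjoint sigma \o phi]
    or its adjoint completely positive. The identity map gives the way back to [dual_cone K phi]. *)
Lemma right_module_equiv :
  [<->
    comp_set K (completely_positive a a) `<=` K;
    forall phi, hermitian_preserving a b phi ->
      (dual_cone K phi <-> forall psi,
        completely_positive a a psi ->
        choi_set (dual_cone K) (tensmap (idmap a) phi (choi psi)));
    forall phi, hermitian_preserving a b phi ->
      (dual_cone K phi <-> forall psi,
        completely_positive a a psi ->
        choi_set (dual_cone (adjoint_set K))
          (tensmap (idmap b) psi (choi (adjoint phi))));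
    forall phi, hermitian_preserving a b phi ->
      (dual_cone K phi <-> forall sigma, K sigma ->
        psdmx (tensmap (idmap a) (adjoint sigma) (choi phi)));
    forall phi, hermitian_preserving a b phi ->
      (dual_cone K phi <-> forall sigma, K sigma ->
        psdmx (tensmap (idmap a) (adjoint phi) (choi sigma)))].
Proof.
have cond_iii (phi : Map) psi : choi_set (dual_cone (adjoint_set K))
    (tensmap (idmap b) psi (choi (adjoint phi))) <->
    dual_cone K (phi \o adjoint psi)%VF.
  by rewrite tensmap_idl_choi choi_setP dual_cone_adjoint adjoint_comp adjointK.
have cond_iv (phi : Map) sigma :
    psdmx (tensmap (idmap a) (adjoint sigma) (choi phi)) <->
    completely_positive a a (adjoint sigma \o phi)%VF.
  by rewrite tensmap_idl_choi completely_positiveP.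
(* By the bipolar property, membership of [sigma \o psi] in [K] is tested against the dual cone. *)
have stable_of_pairing : (forall phi psi sigma, dual_cone K phi ->
      completely_positive a a psi -> K sigma ->
      0 <= map_pairing (sigma \o psi)%VF phi) ->
    comp_set K (completely_positive a a) `<=` K.
  move=> pair_ge0 _ [sigma Ksigma [psi psiCP <-]]; apply: K_bipolar => [|phi phiK].
    apply: hermitian_preserving_comp; first exact: KH.
    exact: completely_positive_hermitian.
  exact: pair_ge0.
have ii_i : (forall phi, hermitian_preserving a b phi ->
      (dual_cone K phi <-> forall psi, completely_positive a a psi ->
        choi_set (dual_cone K) (tensmap (idmap a) phi (choi psi)))) ->
    comp_set K (completely_positive a a) `<=` K.
  move=> ii; apply: stable_of_pairing => phi psi sigma phiK psiCP Ksigma.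
  have := (ii phi phiK.1).1 phiK _ (completely_positive_adjoint psiCP).
  rewrite tensmap_idl_choi choi_setP map_pairing_compr => -[_]; exact.
tfae.
- move=> stable phi phiH; split=> [phiK psi psiCP|].
    rewrite tensmap_idl_choi choi_setP; split=> [|sigma Ksigma].
      exact/(hermitian_preserving_comp phiH)/completely_positive_hermitian.
    (* Moving [psi] across the pairing replaces it by its adjoint, which is again completely
       positive. *)
    rewrite -[psi]adjointK -map_pairing_compr; apply: phiK.2.
    apply: stable; exists sigma => //; exists (adjoint psi) => //.
    exact: completely_positive_adjoint.
  move=> /(_ _ (@completely_positive_id C a)).
  by rewrite tensmap_idl_choi choi_setP comp_lfun1r.
- move=> ii phi phiH; rewrite (ii phi phiH).
  split=> h psi /completely_positive_adjoint/h.
    by rewrite tensmap_idl_choi choi_setP cond_iii.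
  by rewrite cond_iii adjointK tensmap_idl_choi choi_setP.
- move=> iii.
  have stable : comp_set K (completely_positive a a) `<=` K.
    apply: ii_i => phi phiH; rewrite (iii phi phiH).
    (* The second and third conditions differ by the substitution of [adjoint psi] for [psi], which
       permutes the completely positive maps. *)
    split=> h psi /completely_positive_adjoint/h.
      by rewrite cond_iii adjointK tensmap_idl_choi choi_setP.
    by rewrite tensmap_idl_choi choi_setP cond_iii.
  move=> phi phiH; split=> [phiK sigma Ksigma|phiP].
    rewrite cond_iv; apply: completely_positive_self_dual => [|psi psiCP].
      exact/(hermitian_preserving_comp _ phiH)/hermitian_preserving_adjoint/KH.
    rewrite -map_pairing_compl; apply: phiK.2.
    by apply: stable; exists sigma => //; exists psi.
  split=> // sigma Ksigma.
  have := phiP _ Ksigma; rewrite cond_iv.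
  (* The pairing of the identity with [adjoint sigma \o phi] is that of [sigma] with [phi]. *)
  move=> /(map_pairing_completely_positive (@completely_positive_id C a)).
  by rewrite -map_pairing_compl comp_lfun1r.
- move=> iv phi phiH; rewrite (iv phi phiH).
  (* The two maps involved are adjoint to each other, so they are completely positive together. *)
  suff condE sigma : psdmx (tensmap (idmap a) (adjoint sigma) (choi phi)) <->
      psdmx (tensmap (idmap a) (adjoint phi) (choi sigma)).
    by split=> h sigma /h /condE.
  rewrite cond_iv tensmap_idl_choi -completely_positiveP.
  by rewrite -completely_positive_adjointP adjoint_comp adjointK.
- move=> v; apply: stable_of_pairing => phi psi sigma phiK psiCP Ksigma.
  have := (v phi phiK.1).1 phiK _ Ksigma.
  rewrite tensmap_idl_choi -completely_positiveP => /completely_positive_adjoint.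
  rewrite adjoint_comp adjointK map_pairing_compl.
  exact: map_pairing_completely_positive.
Qed.

(** The mirror image, with composition on the other side. Here the second and third conditions both
    put [psi \o phi] in the dual cone, for the same [psi]. *)
Lemma left_module_equiv :
  [<->
    comp_set (completely_positive b b) K `<=` K;
    forall phi, hermitian_preserving a b phi ->
      (dual_cone K phi <-> forall psi,
        completely_positive b b psi ->
        choi_set (dual_cone K) (tensmap (adjoint phi) (idmap b) (choi psi)));
    forall phi, hermitian_preserving a b phi ->
      (dual_cone K phi <-> forall psi,
        completely_positive b b psi ->
        choi_set (dual_cone (adjoint_set K))
          (tensmap psi (idmap a) (choi (adjoint phi))));
    forall phi, hermitian_preserving a b phi ->
      (dual_cone K phi <-> forall sigma, K sigma ->
        psdmx (tensmap sigma (idmap b) (choi phi)));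
    forall phi, hermitian_preserving a b phi ->
      (dual_cone K phi <-> forall sigma, K sigma ->
        psdmx (tensmap phi (idmap b) (choi sigma)))].
Proof.
have cond_vii (phi : Map) psi : choi_set (dual_cone K)
    (tensmap (adjoint phi) (idmap b) (choi psi)) <-> dual_cone K (psi \o phi)%VF.
  by rewrite tensmap_idr_choi choi_setP adjointK.
have cond_viii (phi : Map) psi : choi_set (dual_cone (adjoint_set K))
    (tensmap psi (idmap a) (choi (adjoint phi))) <->
    dual_cone K (psi \o phi)%VF.
  by rewrite tensmap_idr_choi choi_setP dual_cone_adjoint adjoint_comp !adjointK.
have cond_ix (phi : Map) sigma : psdmx (tensmap sigma (idmap b) (choi phi)) <->
    completely_positive b b (phi \o adjoint sigma)%VF.
  by rewrite tensmap_idr_choi completely_positiveP.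
have stable_of_pairing : (forall phi psi sigma, dual_cone K phi ->
      completely_positive b b psi -> K sigma ->
      0 <= map_pairing (psi \o sigma)%VF phi) ->
    comp_set (completely_positive b b) K `<=` K.
  move=> pair_ge0 _ [psi psiCP [sigma Ksigma <-]]; apply: K_bipolar => [|phi phiK].
    apply: hermitian_preserving_comp; last exact: KH.
    exact: completely_positive_hermitian.
  exact: pair_ge0.
have vii_vi : (forall phi, hermitian_preserving a b phi ->
      (dual_cone K phi <-> forall psi, completely_positive b b psi ->
        choi_set (dual_cone K) (tensmap (adjoint phi) (idmap b) (choi psi)))) ->
    comp_set (completely_positive b b) K `<=` K.
  move=> vii; apply: stable_of_pairing => phi psi sigma phiK psiCP Ksigma.
  have := (vii phi phiK.1).1 phiK _ (completely_positive_adjoint psiCP).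
  rewrite cond_vii map_pairing_compl => -[_]; exact.
tfae.
- move=> stable phi phiH; split=> [phiK psi psiCP|].
    rewrite cond_vii; split=> [|sigma Ksigma].
      exact/hermitian_preserving_comp/phiH/completely_positive_hermitian.
    rewrite -[psi]adjointK -map_pairing_compl; apply: phiK.2.
    apply: stable; exists (adjoint psi); last by exists sigma.
    exact: completely_positive_adjoint.
  move=> /(_ _ (@completely_positive_id C b)).
  by rewrite cond_vii comp_lfun1l.
- move=> vii phi phiH; rewrite (vii phi phiH).
  by split=> h psi /h; rewrite cond_vii cond_viii.
- move=> viii.
  have stable : comp_set (completely_positive b b) K `<=` K.
    apply: vii_vi => phi phiH; rewrite (viii phi phiH).
    by split=> h psi /h; rewrite cond_vii cond_viii.
  move=> phi phiH; split=> [phiK sigma Ksigma|phiP].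
    rewrite cond_ix; apply: completely_positive_self_dual => [|psi psiCP].
      exact/(hermitian_preserving_comp phiH)/hermitian_preserving_adjoint/KH.
    rewrite -map_pairing_compr; apply: phiK.2.
    by apply: stable; exists psi => //; exists sigma.
  split=> // sigma Ksigma.
  have := phiP _ Ksigma; rewrite cond_ix.
  (* The pairing of the identity with [phi \o adjoint sigma] is again that of [sigma] with [phi]. *)
  move=> /(map_pairing_completely_positive (@completely_positive_id C b)).
  by rewrite -map_pairing_compr comp_lfun1l.
- move=> ix phi phiH; rewrite (ix phi phiH).
  suff condE sigma : psdmx (tensmap sigma (idmap b) (choi phi)) <->
      psdmx (tensmap phi (idmap b) (choi sigma)).
    by split=> h sigma /h /condE.
  by rewrite !cond_ix -completely_positive_adjointP adjoint_comp adjointK.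
- move=> x; apply: stable_of_pairing => phi psi sigma phiK psiCP Ksigma.
  have := (x phi phiK.1).1 phiK _ Ksigma.
  rewrite cond_ix => /completely_positive_adjoint.
  rewrite adjoint_comp adjointK map_pairing_compr.
  exact: map_pairing_completely_positive.
Qed.

End MappingCones.

Theorem theorem4p4 (R : realType) (a b : nat)
    (K : set 'Hom('M[R[i]]_a, 'M[R[i]]_b))
    (KH : K `<=` hermitian_preserving a b) (Kcone : closed_convex_cone K) :
  [<->
    comp_set K (completely_positive a a) `<=` K;
    forall phi, hermitian_preserving a b phi ->
      (dual_cone K phi <-> forall psi,
        completely_positive a a psi ->
        choi_set (dual_cone K) (tensmap (idmap a) phi (choi psi)));
    forall phi, hermitian_preserving a b phi ->
      (dual_cone K phi <-> forall psi,
        completely_positive a a psi ->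
        choi_set (dual_cone (adjoint_set K))
          (tensmap (idmap b) psi (choi (adjoint phi))));
    forall phi, hermitian_preserving a b phi ->
      (dual_cone K phi <-> forall sigma, K sigma ->
        psdmx (tensmap (idmap a) (adjoint sigma) (choi phi)));
    forall phi, hermitian_preserving a b phi ->
      (dual_cone K phi <-> forall sigma, K sigma ->
        psdmx (tensmap (idmap a) (adjoint phi) (choi sigma)))]
  /\
  [<->
    comp_set (completely_positive b b) K `<=` K;
    forall phi, hermitian_preserving a b phi ->
      (dual_cone K phi <-> forall psi,
        completely_positive b b psi ->
        choi_set (dual_cone K) (tensmap (adjoint phi) (idmap b) (choi psi)));
    forall phi, hermitian_preserving a b phi ->
      (dual_cone K phi <-> forall psi,
        completely_positive b b psi ->
        choi_set (dual_cone (adjoint_set K))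
          (tensmap psi (idmap a) (choi (adjoint phi))));
    forall phi, hermitian_preserving a b phi ->
      (dual_cone K phi <-> forall sigma, K sigma ->
        psdmx (tensmap sigma (idmap b) (choi phi)));
    forall phi, hermitian_preserving a b phi ->
      (dual_cone K phi <-> forall sigma, K sigma ->
        psdmx (tensmap phi (idmap b) (choi sigma)))].
Proof.
have K_bipolar f := bipolar KH Kcone (f := f).
split; [exact: right_module_equiv|exact: left_module_equiv].
Qed.
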